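(* For each $g\in\mathbb{N}_0$, $n_{g,1}\leq n_{g+1,1}$.
   Context: $\mathbb{N}_0$ is the set of non-negative integers. A numerical semigroup is a subset of $\mathbb{N}_0$ that is closed under addition, contains $0$, and has finite complement in $\mathbb{N}_0$. The elements of the complement are called gaps, the number of gaps is the genus, the largest gap is the Frobenius number, and the smallest non-zero element of the semigroup is its multiplicity. A numerical semigroup of genus $g$ is ordinary if its gaps are all in a row, i.e. it equals $\{0,g+1,g+2,\dots\}$; $\mathbb{N}_0$ (genus $0$) counts as ordinary. The ordinarization transform $\Lambda'$ of a non-ordinary numerical semigroup $\Lambda$ with Frobenius number $F$ and multiplicity $m$ is $(\Lambda\setminus\{m\})\cup\{F\}$, which is a numerical semigroup of the same genus; the ordinarization transform of an ordinary semigroup is itself. Put $\Lambda^{(0)}=\Lambda$ and $\Lambda^{(i)}=(\Lambda^{(i-1)})'$. The ordinarization number of $\Lambda$ is the smallest $i\geq 0$ such that $\Lambda^{(i)}$ is ordinary (such $i$ exists). $n_{g,r}$ denotes the number of numerical semigroups of genus $g$ and ordinarization number $r$. *)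

(* Defs.v *)
From mathcomp Require Import all_boot all_order.
From mathcomp Require Import finmap.
From mathcomp Require Import boolp classical_sets functions cardinality.

Set Implicit Arguments.
Unset Strict Implicit.
Unset Printing Implicit Defensive.

Local Open Scope classical_set_scope.

Definition numerical_semigroup (L : set nat) : Prop :=
  [/\ L 0, (forall a b, L a -> L b -> L (a + b)) & finite_set (~` L)].

(* Both are 0 by convention when there is no least (greatest) element. *)
Definition least (A : set nat) : nat := xget 0 (A `&` lbound A).
Definition greatest (A : set nat) : nat := xget 0 (A `&` ubound A).

Definition gaps (L : set nat) : set nat := ~` L.

(* [fset_set A] is the finite set with the elements of A when A is finite
   (and is empty otherwise). *)
Definition genus (L : set nat) : nat := #|` fset_set (gaps L)|.

Definition frobenius (L : set nat) : nat := greatest (gaps L).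

Definition multiplicity (L : set nat) : nat := least (L `\ 0).

Definition ordinary (L : set nat) : Prop :=
  L = [set n | n = 0 \/ genus L < n].

Definition ordinarization (L : set nat) : set nat :=
  if pselect (ordinary L) then L
  else (L `\ multiplicity L) `|` [set frobenius L].

Definition ordinarization_number (L : set nat) : nat :=
  least [set i | ordinary (iter i ordinarization L)].

Definition semigroups_of (g r : nat) : set (set nat) :=
  [set L | [/\ numerical_semigroup L, genus L = g
             & ordinarization_number L = r]].

Definition n_ (g r : nat) : nat := #|` fset_set (semigroups_of g r)|.

Lemma gap_lt_double_genus (L : set nat) (x : nat) :
  numerical_semigroup L -> gaps L x -> x < (genus L).*2.
Proof.
move=> [L0 LD Lfin] gx.
have inS y : (y \in fset_set (gaps L)) = (y \in gaps L).
  by rewrite in_fset_set.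
rewrite -addnn {2}/genus /genus.
set S := fset_set (gaps L) in inS *.
have -> : #|` S| + #|` S| = size (S ++ [seq x - y | y <- S]).
  by rewrite size_cat size_map.
rewrite -(size_iota 0 x.+1); apply: uniq_leq_size (iota_uniq _ _) _ => a.
rewrite mem_iota add0n ltnS /= => ax; rewrite mem_cat.
have [La|Na] := pselect (L a); last by rewrite inS; apply/orP; left; apply/mem_set.
apply/orP; right; apply/mapP; exists (x - a); last by rewrite subKn.
rewrite inS; apply/mem_set => Lxa; apply: gx.
by rewrite -(subnKC ax); apply: LD.
Qed.

(* Hence [n_ g r] is a genuine count. *)
Lemma finite_semigroups_of (g r : nat) : finite_set (semigroups_of g r).
Proof.
pose f (X : {set 'I_(g.*2)}) : set nat :=
  ~` [set n | exists2 i : 'I_(g.*2), i \in X & nat_of_ord i = n].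
apply: (@sub_finite_set _ _ (f @` [set: {set 'I_(g.*2)}])); last first.
  by apply: finite_image; apply: finite_finset.
move=> L [Lsg Lg _]; exists [set i : 'I_(g.*2) | `[< gaps L i >]]%SET => //.
rewrite /f -[RHS]setCK; congr (~` _); apply/seteqP; split=> n /=.
  by case=> i; rewrite inE => /asboolP gi <-.
move=> gn; have ng : n < g.*2 by rewrite -Lg; exact: gap_lt_double_genus.
by exists (Ordinal ng) => //; rewrite inE; apply/asboolP.
Qed.

(* Main.v *)
Require Import Defs.
From mathcomp Require Import all_boot.
From mathcomp Require Import finmap zify.
From mathcomp Require Import boolp classical_sets functions cardinality.

(** A non-ordinary semigroup [L] of genus [g] has ordinarization number 1
    exactly when one exchange of its multiplicity [m] for its Frobenius number
    [F] produces [{0, g+1, g+2, ...}].  Undoing the exchange, [L] must be the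
    set [{0, m} `|` {n > g, n != F}] with [0 < m <= g < F].  Such a set is closed
    under addition if and only if no sum of two nonzero elements is a gap:
    - [m + m] must not be a small gap, so [g < 2m], and must not be [F];
    - [m + x] with [x > g] must not be [F], that is [F - m] must be a gap, so
      [F <= g + m];
    - [x + y] with [x, y > g] then exceeds [F] since [F <= g + m <= 2g].
    Hence the semigroups counted by [n_ g 1] are parametrized by the pairs
    [(m, F)] with [m <= g < F <= g + m] and [g < 2m != F] ([admissible_pair]
    and [exchange_semigroups_of]).  These conditions are inherited by
    [(m + 1, F + 2)] in genus [g + 1]: the upper bound on [F] grows by exactly
    2, and so does the forbidden value [2m].  The pair being recovered from
    the semigroup as multiplicity and Frobenius number, this defines an
    injection from the semigroups of genus [g] and ordinarization number 1 to
    those of genus [g + 1] and ordinarization number 1. *)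

Set Implicit Arguments.
Unset Strict Implicit.
Unset Printing Implicit Defensive.

Local Open Scope classical_set_scope.

Lemma least_eq (A : set nat) (x : nat) :
  A x -> (forall y, A y -> x <= y) -> least A = x.
Proof.
move=> Ax minx; apply: xget_unique => [|y [Ay miny]]; first by split.
by apply/eqP; rewrite eqn_leq minx // andbT; apply: miny.
Qed.

Lemma greatest_eq (A : set nat) (x : nat) :
  A x -> (forall y, A y -> y <= x) -> greatest A = x.
Proof.
move=> Ax maxx; apply: xget_unique => [|y [Ay maxy]]; first by split.
by apply/eqP; rewrite eqn_leq maxx //=; apply: maxy.
Qed.

Lemma least_mem (A : set nat) : A !=set0 -> A (least A).
Proof.
case=> x Ax; have exA : exists n, `[< A n >] by exists x; apply/asboolP.
case: (ex_minnP exA) => m /asboolP Am minm.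
by rewrite (@least_eq _ m) // => y Ay; apply: minm; apply/asboolP.
Qed.

Lemma greatest_mem (A : set nat) (b : nat) :
  A !=set0 -> (forall x, A x -> x <= b) -> A (greatest A).
Proof.
case=> x Ax ubA; have exA : exists n, `[< A n >] by exists x; apply/asboolP.
have ubA' n : `[< A n >] -> n <= b by move/asboolP/ubA.
case: (ex_maxnP exA ubA') => m /asboolP Am maxm.
by rewrite (@greatest_eq _ m) // => y Ay; apply: maxm; apply/asboolP.
Qed.

(** The default value of [least] is 0, so a nonzero value is attained. *)
Lemma least_gt0 (A : set nat) : 0 < least A -> A (least A) /\ ~ A 0.
Proof.
rewrite /least; case: xgetP => [n _ [An lbn] n_gt0|//].
by split=> // A0; have : n <= 0 := lbn 0 A0; rewrite leqNgt n_gt0.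
Qed.

Definition exchange (L : set nat) (m F : nat) : set nat := (L `\ m) `|` [set F].

Lemma genus_exchange (L : set nat) (m F : nat) :
  finite_set (gaps L) -> L m -> gaps L F -> genus (exchange L m F) = genus L.
Proof.
move=> finL Lm gF; rewrite /genus.
have -> : gaps (exchange L m F) = m |` (gaps L `\ F).
  apply/seteqP; split=> n; rewrite /gaps /exchange /=.
    move=> /not_orP[nLm nF]; have [->|nm] := eqVneq n m; first by left.
    by right; split=> // Ln; apply: nLm; split=> //; apply/eqP.
  case=> [->|[nL nF]] [[Ln nm]|//].
  - exact: nm.
  - by move=> mF; apply: gF; rewrite -mF.
  - exact: nL.
rewrite fset_setU1; last exact: finite_setD.
rewrite fset_setD1 // cardfsU1 (cardfsD1 F (fset_set (gaps L))).
rewrite !inE !in_fset_set // (mem_set gF).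
by rewrite (memNset (_ : ~ gaps L m)) ?andbF //; apply.
Qed.

Definition ordinary_set (g : nat) : set nat := [set n | n = 0 \/ g < n].

Lemma genus_ordinary_set (g : nat) : genus (ordinary_set g) = g.
Proof.
apply: card_fset_set; rewrite (_ : gaps _ = `I_g.+1 `\` `I_1).
  by have := @card_IID g.+1 1; rewrite subn1.
apply/seteqP; split=> n; rewrite /gaps /ordinary_set /= ltnS.
  by move=> /not_orP[n0 ng]; split; lia.
by move=> [ng n0] [|]; lia.
Qed.

Lemma ordinary_ordinary_set (g : nat) : ordinary (ordinary_set g).
Proof. by rewrite /ordinary genus_ordinary_set. Qed.

Lemma ordinarizationE (L : set nat) : ~ ordinary L ->
  ordinarization L = exchange L (multiplicity L) (frobenius L).
Proof. by move=> nL; rewrite /ordinarization; case: pselect. Qed.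

Lemma multiplicity_mem (L : set nat) : numerical_semigroup L ->
  (L `\ 0) (multiplicity L).
Proof.
move=> Lsg; apply: least_mem; exists (genus L).*2.+1; split=> //=.
by apply: contrapT => /(gap_lt_double_genus Lsg); rewrite ltnNge leqnSn.
Qed.

Lemma frobenius_gap (L : set nat) :
  numerical_semigroup L -> ~ ordinary L -> gaps L (frobenius L).
Proof.
move=> Lsg nordL; apply: (@greatest_mem _ (genus L).*2); last first.
  by move=> x /(gap_lt_double_genus Lsg)/ltnW.
apply: contrapT => noGap; apply: nordL.
have LT : L = setT.
  by apply/seteqP; split=> // n _; apply: contrapT => gn; apply: noGap; exists n.
have -> : L = ordinary_set 0.
  by rewrite LT; apply/seteqP; split=> // -[|n] _; [left|right].
exact: ordinary_ordinary_set.
Qed.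

(** The undoing of an exchange that produced [ordinary_set g]. *)
Definition near_ordinary (g m F : nat) : set nat :=
  [set n | [\/ n = 0, n = m | g < n /\ n <> F]].

(** The positivity of [m] is implied by [g < m.*2]. *)
Definition admissible_pair (g m F : nat) : bool :=
  [&& m <= g, g < F, F <= g + m, g < m.*2 & F != m.*2].

Section NearOrdinary.
Variables (g m F : nat).
Hypothesis adm : admissible_pair g m F.

Lemma near_ordinary_semigroup : numerical_semigroup (near_ordinary g m F).
Proof.
move: adm => /and5P[mg gF Fgm gm Fm]; split; first by constructor 1.
  move=> a b [->|->|[ga aF]] [->|->|[gb bF]];
    rewrite ?add0n ?addn0;
    by [constructor 1 | constructor 2 | constructor 3; split; lia].
apply: (@sub_finite_set _ _ `I_F.+1); last exact: finite_II.
move=> n /= nn; rewrite ltnNge; apply/negP => Fn; apply: nn.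
by constructor 3; split; lia.
Qed.

Lemma multiplicity_near_ordinary : multiplicity (near_ordinary g m F) = m.
Proof.
move: adm => /and5P[mg gF Fgm gm Fm]; apply: least_eq.
  by split; [constructor 2 | move=> /= ?; lia].
by move=> y [] [->|->|[gy _]] //= _; lia.
Qed.

Lemma gap_near_ordinary : gaps (near_ordinary g m F) F.
Proof. by move: adm => /and5P[mg gF Fgm gm Fm] [||[]] //; lia. Qed.

Lemma frobenius_near_ordinary : frobenius (near_ordinary g m F) = F.
Proof.
move: adm => /and5P[mg gF Fgm gm Fm]; apply: greatest_eq.
  exact: gap_near_ordinary.
move=> y gy; rewrite leqNgt; apply/negP => Fy; apply: gy.
by constructor 3; split; lia.
Qed.

(** An ordinary semigroup contains all numbers above any nonzero element. *)
Lemma near_ordinary_not_ordinary : ~ ordinary (near_ordinary g m F).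
Proof.
move: adm => /and5P[mg gF Fgm gm Fm] ord; apply: gap_near_ordinary.
have : near_ordinary g m F m by constructor 2.
by rewrite ord => -[m0|gen_m]; [lia | right; lia].
Qed.

Lemma exchange_near_ordinary :
  exchange (near_ordinary g m F) m F = ordinary_set g.
Proof.
move: adm => /and5P[mg gF Fgm gm Fm]; apply/seteqP; split=> n.
  by move=> [[[->|->|[gn _]] nm]|->]; [left | case: nm | right | right].
have [->|nF] := eqVneq n F; first by right.
by case=> [->|gn]; left; split=> /=;
  [constructor 1 | lia | constructor 3; split=> //; apply/eqP | lia].
Qed.

Lemma near_ordinary_semigroups_of : semigroups_of g 1 (near_ordinary g m F).
Proof.
have sg := near_ordinary_semigroup; split=> //.
  rewrite -(@genus_exchange _ m F).
  - by rewrite exchange_near_ordinary genus_ordinary_set.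
  - by case: sg.
  - by constructor 2.
  - exact: gap_near_ordinary.
apply: least_eq => [|[|//] /near_ordinary_not_ordinary//].
rewrite /= ordinarizationE; last exact: near_ordinary_not_ordinary.
rewrite multiplicity_near_ordinary frobenius_near_ordinary.
by rewrite exchange_near_ordinary; exact: ordinary_ordinary_set.
Qed.

End NearOrdinary.

(** Ordinarization preserves the genus, so it can only produce
    [ordinary_set g]; closure under addition of [L] then gives the bounds. *)
Lemma exchange_semigroups_of (g : nat) (L : set nat) : semigroups_of g 1 L ->
  admissible_pair g (multiplicity L) (frobenius L) /\
  L = near_ordinary g (multiplicity L) (frobenius L).
Proof.
move=> [Lsg Lg L1].
have [ordL' nordL] : ordinary (ordinarization L) /\ ~ ordinary L.
  have := @least_gt0 [set i | ordinary (iter i ordinarization L)].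
  by rewrite -/(ordinarization_number L) L1; apply.
have [Lm m0] := multiplicity_mem Lsg; have gF := frobenius_gap Lsg nordL.
move: ordL'; rewrite ordinarizationE //.
move: (multiplicity L) (frobenius L) Lm m0 gF => m F Lm /= m0 gF.
have [L0 LD Lfin] := Lsg.
rewrite /ordinary genus_exchange // Lg -/(ordinary_set g) => exL.
have mF : m <> F by move=> mF; apply: gF; rewrite -mF.
have F0 : F <> 0 by move=> F0; apply: gF; rewrite F0.
have LE n : L n <-> near_ordinary g m F n.
  have [->|nm] := eqVneq n m; first by split=> // _; constructor 2.
  have [->|nF] := eqVneq n F; first by split=> [/gF//|[|/esym/mF|[]]].
  have : exchange L m F n <-> L n.
    split=> [[[]//|/eqP]|Ln]; first by rewrite (negbTE nF).
    by left; split=> //; apply/eqP.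
  rewrite exL => <-; split=> [[->|gn]|[->|/eqP|[gn _]]].
  - by constructor 1.
  - by constructor 3; split=> //; apply/eqP.
  - by left.
  - by rewrite (negbTE nm).
  - by right.
have gltF : g < F by have [//|] : ordinary_set g F by rewrite -exL; right.
have mleg : m <= g.
  rewrite leqNgt; apply/negP => gm.
  have : ordinary_set g m by right.
  by rewrite -exL => -[[_ /=]|].
split; last by apply/seteqP; split=> n /LE.
have L2m := (LE _).1 (LD _ _ Lm Lm).
apply/and5P; split=> //; rewrite -?addnn.
- rewrite leqNgt; apply/negP => Fgm; apply: gF.
  rewrite -(@subnKC m F); last by lia.
  by apply: LD => //; apply/LE; constructor 3; split; lia.
- by case: L2m => [||[]]; lia.
- by apply/eqP => FE; apply: gF; rewrite FE; apply: LD.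
Qed.

Lemma admissible_pair_shift (g m F : nat) :
  admissible_pair g m F -> admissible_pair g.+1 m.+1 F.+2.
Proof. by move=> /and5P[*]; apply/and5P; split; lia. Qed.

Theorem corollary9 (g : nat) : n_ g 1 <= n_ g.+1 1.
Proof.
pose shift L := near_ordinary g.+1 (multiplicity L).+1 (frobenius L).+2.
have shift_inj : {in semigroups_of g 1 &, injective shift}.
  move=> L1 L2 /set_mem /exchange_semigroups_of[adm1 L1E].
  move=> /set_mem /exchange_semigroups_of[adm2 L2E] eq12.
  move: adm1 adm2 => /admissible_pair_shift adm1 /admissible_pair_shift adm2.
  have := congr1 multiplicity eq12; rewrite !multiplicity_near_ordinary //.
  have := congr1 frobenius eq12; rewrite !frobenius_near_ordinary //.
  by move=> [eqF] [eqm]; rewrite L1E L2E eqF eqm.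
have fin := finite_semigroups_of.
have finI : finite_set (shift @` semigroups_of g 1) by exact: finite_image.
rewrite /n_ -((fcard_eq finI (fin g 1)) (inj_card_eq shift_inj)).
apply: fsubset_leq_card; rewrite -fset_set_sub // => _ [L Lg <-].
have [/admissible_pair_shift adm _] := exchange_semigroups_of Lg.
exact: near_ordinary_semigroups_of.
Qed.
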